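(* Let $\mathcal{H}=\mathcal{H}(\Omega)$ be a reproducing kernel Hilbert space, let $\sigma$ be a symmetric mean, let $\sigma_t$ ($t\in[0,1]$) be an interpolation path of $\sigma$, and let $p\ge 1$. Suppose $A\in B(\mathcal{H})$ is invertible. Then $A$ is unitary if and only if $\|A^*A\|_{ber_{\sigma_t}}\le 1$ and $\|(A^*A)^{-1}\|_{ber_{\sigma_t}}\le 1$.
   Context: A reproducing kernel Hilbert space $\mathcal{H}=\mathcal{H}(\Omega)$ on a nonempty set $\Omega$ is a Hilbert space of complex-valued functions on $\Omega$ whose point evaluations are bounded; $k_\lambda\in\mathcal H$ is the reproducing kernel at $\lambda\in\Omega$ (so $f(\lambda)=\langle f,k_\lambda\rangle$ for all $f\in\mathcal H$), and $\hat k_\lambda=k_\lambda/\|k_\lambda\|$ is the normalized reproducing kernel (implicitly $k_\lambda\ne 0$ for all $\lambda$). $B(\mathcal H)$ is the algebra of bounded linear operators on $\mathcal H$. A mean is a function $\sigma:[0,\infty)\times[0,\infty)\to[0,\infty)$, written $a\,\sigma\, b=\sigma(a,b)$, such that: $\sigma(a,b)\ge 0$; $a\le b$ implies $a\le a\,\sigma\, b\le b$; $\sigma$ is increasing in both variables; $\sigma(\alpha a,\alpha b)=\alpha\,\sigma(a,b)$ for $\alpha>0$; $\sigma$ is continuous. It is symmetric if $a\,\sigma\, b=b\,\sigma\, a$ for all $a,b$. An interpolation path for a symmetric mean $\sigma$ is a family of means $\sigma_t$, $t\in[0,1]$, such that: (i) $a\,\sigma_0\, b=b$, $a\,\sigma_1\,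 b=a$, $a\,\sigma_{1/2}\, b=a\,\sigma\, b$ for all $a,b\ge0$; (ii) $(a\,\sigma_t\, b)\,\sigma\,(a\,\sigma_s\, b)=a\,\sigma_{(t+s)/2}\, b$ for all $s,t\in[0,1]$; (iii) each $\sigma_t$ is increasing in each component. For $A\in B(\mathcal H)$, $t\in[0,1]$ and $p\ge1$, the $\sigma_t$-Berezin norm is $\|A\|_{ber_{\sigma_t}}=\sup_{\lambda,\mu\in\Omega}\left(|\langle A\hat k_\lambda,\hat k_\mu\rangle|^p\,\sigma_t\,|\langle A^*\hat k_\lambda,\hat k_\mu\rangle|^p\right)^{1/p}$. *)

(* Defs.v *)
From HB Require Import structures.
From mathcomp Require Import all_boot all_order all_algebra.
From mathcomp Require Import sesquilinear complex.
From mathcomp Require Import all_classical all_reals all_analysis.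

Set Implicit Arguments.
Unset Strict Implicit.
Unset Printing Implicit Defensive.

Import Order.TTheory GRing.Theory Num.Def Num.Theory.
Import numFieldNormedType.Exports.

Local Open Scope classical_set_scope.
Local Open Scope ring_scope.
Local Open Scope complex_scope.

Definition bounded_map (K : numFieldType) (V W : normedModType K)
    (f : V -> W) : Prop :=
  exists M : K, forall x, `|f x| <= M * `|x|.

(* The elements of the Hilbert space are identified with complex-valued
   functions on Omega by the injective linear map rkhs_val. The inner product
   is linear in its first argument. *)
Record rkhs (R : realType) (Omega : Type) := Rkhs {
  rkhs_space :> completeNormedModType R[i];
  rkhs_dot : {dot rkhs_space for @conjC R[i]};
  rkhs_norm : forall f : rkhs_space, `|f| ^+ 2 = rkhs_dot f f;
  rkhs_val : rkhs_space -> Omega -> R[i];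
  rkhs_val_linear : forall (a : R[i]) (f g : rkhs_space) (l : Omega),
    rkhs_val (a *: f + g) l = a * rkhs_val f l + rkhs_val g l;
  rkhs_val_inj : injective rkhs_val;
  rkhs_val_bounded : forall l : Omega,
    bounded_map (fun f : rkhs_space => rkhs_val f l : R[i]^o)
}.

Arguments rkhs_dot {R Omega} r.
Arguments rkhs_val {R Omega} r f l.

Section Operators.
Context {R : realType} {Omega : Type} (H : rkhs R Omega).
Local Notation dot := (rkhs_dot H).

(* Exists, and is unique, by the Riesz representation theorem. *)
Definition rkernel (l : Omega) : H :=
  xget 0 [set k : H | forall f : H, rkhs_val H f l = dot f k].

Definition nrkernel (l : Omega) : H := `|rkernel l|^-1 *: rkernel l.

Definition bounded_operator (A : H -> H) : Prop := linear A /\ bounded_map A.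

(* Exists, and is unique, for every bounded operator. *)
Definition adjoint (A : H -> H) : H -> H :=
  xget (fun=> 0) [set B : H -> H | bounded_operator B /\
    forall f g : H, dot (A f) g = dot f (B g)].

Definition is_inverse (A B : H -> H) : Prop :=
  [/\ bounded_operator B, cancel A B & cancel B A].

Definition invertible_operator (A : H -> H) : Prop :=
  exists B : H -> H, is_inverse A B.

(* Meaningful when A is invertible. *)
Definition op_inv (A : H -> H) : H -> H := xget (fun=> 0) (is_inverse A).

Definition unitary_operator (A : H -> H) : Prop :=
  adjoint A \o A = id /\ A \o adjoint A = id.

(* `|z| lives in R[i], hence the real part. *)
Definition absc (z : R[i]) : R := complex.Re `|z|.

Definition ber_norm (s : R -> R -> R) (p : R) (A : H -> H) : \bar R :=
  ereal_sup [set x : \bar R | exists l m : Omega, x =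
    ((s (absc (dot (A (nrkernel l)) (nrkernel m)) `^ p)
        (absc (dot (adjoint A (nrkernel l)) (nrkernel m)) `^ p)) `^ p^-1)%:E].

End Operators.

(* A mean is a function on [0, +oo[ x [0, +oo[: values of s outside of this
   quadrant are irrelevant. "Increasing" is understood in the wide sense, since
   the endpoints (a, b) |-> b and (a, b) |-> a of an interpolation path are
   means. *)
Record is_mean (R : realType) (s : R -> R -> R) : Prop := IsMean {
  mean_ge0 : forall a b : R, 0 <= a -> 0 <= b -> 0 <= s a b;
  mean_between : forall a b : R, 0 <= a -> a <= b -> a <= s a b <= b;
  mean_incl : forall a a' b : R, 0 <= a -> a <= a' -> 0 <= b -> s a b <= s a' b;
  mean_incr : forall a b b' : R, 0 <= a -> 0 <= b -> b <= b' -> s a b <= s a b';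
  mean_scale : forall c a b : R, 0 < c -> 0 <= a -> 0 <= b ->
    s (c * a) (c * b) = c * s a b;
  mean_continuous : {within [set x : R * R | 0 <= x.1 /\ 0 <= x.2],
    continuous (fun x : R * R => s x.1 x.2)}
}.

Definition symmetric_mean (R : realType) (s : R -> R -> R) : Prop :=
  is_mean s /\ forall a b : R, 0 <= a -> 0 <= b -> s a b = s b a.

Record interpolation_path (R : realType) (s : R -> R -> R)
    (st : R -> R -> R -> R) : Prop := InterpolationPath {
  path_mean : forall t : R, 0 <= t <= 1 -> is_mean (st t);
  path_0 : forall a b : R, 0 <= a -> 0 <= b -> st 0 a b = b;
  path_1 : forall a b : R, 0 <= a -> 0 <= b -> st 1 a b = a;
  path_half : forall a b : R, 0 <= a -> 0 <= b -> st 2^-1 a b = s a b;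
  path_mid : forall t u a b : R, 0 <= t <= 1 -> 0 <= u <= 1 -> 0 <= a -> 0 <= b ->
    s (st t a b) (st u a b) = st ((t + u) / 2) a b;
  path_incl : forall t a a' b : R, 0 <= t <= 1 ->
    0 <= a -> a <= a' -> 0 <= b -> st t a b <= st t a' b;
  path_incr : forall t a b b' : R, 0 <= t <= 1 ->
    0 <= a -> 0 <= b -> b <= b' -> st t a b <= st t a b'
}.

(* Main.v *)
Require Import Defs.
From HB Require Import structures.
From mathcomp Require Import all_boot all_order all_algebra.
From mathcomp Require Import sesquilinear complex.
From mathcomp Require Import all_classical all_reals all_analysis.
From mathcomp Require Import ring lra.

Set Implicit Arguments.
Unset Strict Implicit.
Unset Printing Implicit Defensive.

Import Order.TTheory GRing.Theory Num.Def Num.Theory.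
Import numFieldNormedType.Exports.

Local Open Scope classical_set_scope.
Local Open Scope ring_scope.

(** When [T] equals its own adjoint, both arguments of the mean in the
    Berezin norm of [T] are the same number; a mean fixes the diagonal, so that
    the norm is at most 1 exactly when [|<T k_l, k_m>| <= 1] for all normalized
    kernels (lemma [ber_norm_le1]). This applies to [T = A^* A] and to
    [T^-1 = B B^*], with [B = A^-1].

    If [A] is unitary, both operators are the identity and the bound is the
    Cauchy-Schwarz inequality. Conversely, at [l = m], for a
    normalized kernel [k], the bounds read [|A k|^2 <= 1] and
    [|B^* k|^2 <= 1], while [<A k, B^* k> = <B A k, k> = 1]. Hence
      [|A k - B^* k|^2 = |A k|^2 - 2 Re <A k, B^* k> + |B^* k|^2 <= 0],
    so [A k = B^* k] and [A^* A k = (B A)^* k = k]. A self-adjoint operator that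
    fixes the kernels is the identity, because it does not change the values
    of any function of the space (lemma [self_adjoint_id]). Then
    [A^* = A^* A B = B], and [A] is unitary.

    The existence of adjoints rests on the Riesz representation theorem
    (theorem [riesz]). The representing vector of [phi] is the minimizer of
    [|f|^2 - 2 Re phi f]. By the parallelogram law the sublevel sets close to
    the infimum have small diameter, hence form a Cauchy filter; a
    perturbation argument shows that a near-minimizer represents [phi] up to a
    small error (lemma [energy_near_min]), and this passes to the limit. The
    Cauchy-Schwarz inequality is the case [phi = 0] of that lemma. *)

(** * Squared moduli and squared norms as real numbers *)

Section Modulus.
Context {R : realType}.
Implicit Types z w : R[i].

Definition sqmod z : R := complex.Re z ^+ 2 + complex.Im z ^+ 2.

Lemma sqmod_ge0 z : 0 <= sqmod z.
Proof. by rewrite addr_ge0 ?sqr_ge0. Qed.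

Lemma sqmod_eq0 z : sqmod z = 0 -> z = 0.
Proof.
case: z => a b; rewrite /sqmod /= => /eqP.
by rewrite paddr_eq0 ?sqr_ge0 // !sqrf_eq0 => /andP[/eqP-> /eqP->].
Qed.

Lemma absc_sqr z : absc z ^+ 2 = sqmod z.
Proof. by rewrite /absc normc_def /= sqr_sqrtr ?sqmod_ge0. Qed.

Lemma absc_ge0 z : 0 <= absc z.
Proof. by rewrite /absc normc_def sqrtr_ge0. Qed.

Lemma Re_le_absc z : complex.Re z <= absc z.
Proof.
rewrite (le_trans (ler_norm _)) // -ler_sqr ?nnegrE ?absc_ge0 //.
by rewrite absc_sqr real_normK ?num_real // lerDl sqr_ge0.
Qed.

Lemma sqmodD_le z w : sqmod (z + w) <= 2 * (sqmod z + sqmod w).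
Proof.
case: z w => a b [c d]; rewrite -subr_ge0 /sqmod /=.
rewrite (_ : _ - _ = (a - c) ^+ 2 + (b - d) ^+ 2); last by ring.
by rewrite addr_ge0 ?sqr_ge0.
Qed.

End Modulus.

Section Hilbert.
Context {R : realType} {V : completeNormedModType R[i]}.
Variable dot : {dot V for @conjC R[i]}.
Hypothesis normE : forall f : V, `|f| ^+ 2 = dot f f.
Implicit Types f g h : V.

Definition sqn f : R := complex.Re (dot f f).

Lemma dotJ f g : dot f g = (dot g f)^*.
Proof. by rewrite (hermC dot f g) expr0 mul1r. Qed.

Lemma dotNn f : dot f f = (sqn f)%:C%C.
Proof. by rewrite /sqn RRe_real // ger0_real // dnorm_ge0. Qed.

Lemma sqn_ge0 f : 0 <= sqn f.
Proof. by rewrite -ler0c -dotNn dnorm_ge0. Qed.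

Lemma sqn_eq0 f : sqn f = 0 -> f = 0.
Proof. by move=> n0; apply/eqP; rewrite -(dnorm_eq0 dot) dotNn n0. Qed.

Lemma Re_normK f : complex.Re `|f| ^+ 2 = sqn f.
Proof.
by apply: complexI; rewrite -dotNn -normE rmorphXn /= RRe_real ?normr_real.
Qed.

Lemma norm_lt_sqn f (r : R) : 0 < r -> (`|f| < r%:C%C) = (sqn f < r ^+ 2).
Proof.
move=> r0; rewrite -(RRe_real (normr_real f)) ltcR -Re_normK.
by rewrite ltr_sqr // nnegrE ?(ltW r0) // -ler0c RRe_real ?normr_real.
Qed.

Lemma sqn_addZ f h c :
  sqn (f + c *: h) = sqn f + 2 * complex.Re (c * dot h f) + sqmod c * sqn h.
Proof.
rewrite {1}/sqn linearDl linearDr (linearDr dot (c *: h)) !linearZl_LR !linearZr_LR /=.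
rewrite (dotJ f h) (dotNn h) (dotNn f).
by case: c (dot h f) => a b [x y]; rewrite /sqmod /=; ring.
Qed.


(** * Riesz representation *)

(** If [phi] is represented by [k], this is [|f - k|^2 - |k|^2], which is
    minimal at [f = k]. *)
Definition energy (phi : V -> R[i]) f : R := sqn f - 2 * complex.Re (phi f).

(** Moving from [f] to [f + c h] changes the energy by
    [|c|^2 |h|^2 - 2 Re (c z)], where [z] is the error of representation at [h].
    For [c] equal to [z^*] divided by [|h|^2] this is [- |z|^2 / |h|^2], which
    cannot be below [- e]. *)
Lemma energy_near_min phi f e : scalar phi ->
    (forall g, energy phi f - e <= energy phi g) ->
  forall h, sqmod (phi h - dot h f) <= e * sqn h.
Proof.
move=> phil fmin h; set z := phi h - dot h f.
have J s : 0 <= e - 2 * (s * sqmod z) + s ^+ 2 * sqmod z * sqn h.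
  have := fmin (f + (s%:C * z^*)%C *: h).
  rewrite /energy sqn_addZ (addrC f) phil addrC -subr_ge0.
  congr (0 <= _).
  have -> : phi h = z + dot h f by rewrite subrK.
  case: z (dot h f) (phi f) => a b [x y] [u v]; rewrite /sqmod /=; ring.
have [h0|h0] := eqVneq (sqn h) 0.
  have hV := sqn_eq0 h0; rewrite h0 mulr0.
  have phi0 : phi 0 = 0.
    by have := phil (-1) 0 0; rewrite scaler0 addr0 mulN1r addNr.
  by rewrite /z hV phi0 linear0l subrr /sqmod /= expr0n /= addr0.
have hp : 0 < sqn h by rewrite lt_def h0 sqn_ge0.
have := J (sqn h)^-1.
rewrite (_ : _ + _ = e - sqmod z / sqn h); last by field.
by rewrite subr_ge0 ler_pdivrMr.
Qed.

(** For [phi = 0] the energy is [|f|^2 >= 0], so every [g] minimizes it up to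
    [|g|^2], and the error of representation at [f] is [- <f, g>]. *)
Lemma cauchy_schwarz f g : sqmod (dot f g) <= sqn f * sqn g.
Proof.
have := @energy_near_min (fun=> 0) g (sqn g) _ _ f.
rewrite sub0r mulrC => H.
suff -> : sqmod (dot f g) = sqmod (- dot f g).
  apply: H => [a u v|h]; first by rewrite mulr0 addr0.
  by rewrite /energy /= !mulr0 !subr0 subrr sqn_ge0.
by case: (dot f g) => a b; rewrite /sqmod /=; ring.
Qed.

Lemma sqnZ a f : sqn (a *: f) = sqmod a * sqn f.
Proof.
rewrite -[a *: f]add0r sqn_addZ /sqn linear0l linear0r mulr0 /=.
by rewrite mulr0 addr0 add0r.
Qed.

Lemma scalarDZ phi a f g : scalar phi ->
  phi (a *: (f + g)) = a * phi f + a * phi g.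
Proof.
move=> phil; have phi0 : phi 0 = 0.
  by have := phil (-1) 0 0; rewrite scaler0 addr0 mulN1r addNr.
by rewrite scalerDr phil -[a *: g]addr0 phil phi0 addr0.
Qed.

(** This is the parallelogram law: the linear parts cancel. *)
Lemma sqnB_energy phi f g : scalar phi ->
  sqn (f - g) = 2 * (energy phi f + energy phi g
                     - 2 * energy phi (2^-1 *: (f + g))).
Proof.
move=> phil; rewrite /energy scalarDZ // sqnZ.
have := sqn_addZ f g 1; have := sqn_addZ f g (-1).
rewrite scale1r scaleN1r => -> ->.
have -> : (2^-1 : R[i]) = (2^-1)%:C%C by rewrite fmorphV /= rmorph_nat.
case: (phi f) (phi g) (dot g f) => a b [c d] [x y]; rewrite /sqmod /=.
by field.
Qed.

(** With [r] the norm of [f] and [b] the modulus of a bound of [phi], the energy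
    is at least [r ^ 2 - 2 b r >= - b ^ 2]. *)
Lemma energy_bounded phi : bounded_map (phi : V -> R[i]^o) ->
  exists m, forall f, m <= energy phi f.
Proof.
move=> [M phiM]; exists (- absc M ^+ 2) => f.
have fM : absc (phi f) <= absc M * complex.Re `|f|.
  rewrite -lecR rmorphM /= /absc !RRe_real ?normr_real //.
  apply: le_trans (phiM f) _; rewrite -[X in _ <= _ * X]normr_id -normrM.
  by rewrite ger0_norm // (le_trans (normr_ge0 _) (phiM f)).
rewrite /energy -Re_normK.
have := Re_le_absc (phi f).
have := sqr_ge0 (complex.Re `|f| - absc M).
nra.
Qed.

Theorem riesz phi : scalar phi -> bounded_map (phi : V -> R[i]^o) ->
  exists k, forall f, phi f = dot f k.
Proof.
move=> phil /energy_bounded[m mE].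
pose d := inf (range (energy phi)).
have hE : has_inf (range (energy phi)).
  split; first by exists (energy phi 0), 0.
  by exists m => _ [f _ <-].
have dE f : d <= energy phi f by apply: ge_inf; [exact: hE.2|exists f].
(* The limit is taken along the filter of the sublevel sets of the energy
   just above its infimum. *)
pose S e : set V := [set f | energy phi f < d + e].
have S0 e : 0 < e -> exists f, S e f.
  move=> e0; have [_ [f _ <-] fe] := inf_adherent e0 hE.
  by exists f.
pose F := filter_from [set e : R | 0 < e] S.
have FF : ProperFilter F.
  apply: filter_from_proper; last by move=> e /S0.
  apply: filter_from_filter; first by exists 1 => /=.
  move=> e e' /= e0 e'0; exists (minr e e') => /=; first by rewrite lt_min e0.
  by move=> f; rewrite /S /= addr_minr lt_min => /andP[].
have SB e f g : S e f -> S e g -> sqn (f - g) <= 4 * e.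
  rewrite /S /= => fe ge; rewrite (sqnB_energy f g phil).
  by have := dE (2^-1 *: (f + g)); lra.
have : cauchy F.
  apply/cauchy_ballP => eps eps0.
  rewrite ltcE /= in eps0; case/andP: eps0 => /eqP epsi epsr.
  (* On S e squared distances are at most 4 * e, here half of eps ^ 2. *)
  have e0 : 0 < complex.Re eps ^+ 2 / 8 by rewrite divr_gt0 // exprn_gt0.
  exists (S (complex.Re eps ^+ 2 / 8), S (complex.Re eps ^+ 2 / 8)).
    by split=> /=; exists (complex.Re eps ^+ 2 / 8).
  move=> [f g] [/= fe ge]; rewrite -ball_normE /=.
  have -> : eps = (complex.Re eps)%:C%C by case: eps epsi {e0 fe ge epsr} => a b /= ->.
  rewrite norm_lt_sqn //; have := SB _ _ _ fe ge; lra.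
move=> /cauchy_cvg Fc.
exists (lim F) => h; apply/eqP; rewrite -subr_eq0; apply/eqP/sqmod_eq0.
apply/eqP; rewrite eq_le sqmod_ge0 andbT; apply/ler_addgt0Pr => e e0; rewrite add0r.
have n1 : 0 < 4 * (sqn h + 1) by rewrite mulr_gt0 // ltr_wpDl ?sqn_ge0.
(* The squared error at h is at most twice the sum of the error of the
   near-minimizer f and that of replacing f by the limit, each of them at most
   e' * sqn h. *)
pose e' := e / (4 * (sqn h + 1)).
have e'0 : 0 < e' by rewrite divr_gt0.
have [f [fe fk]] : exists f, S e' f /\ sqn (f - lim F) <= e'.
  have r0 : 0 < Num.sqrt e' by rewrite sqrtr_gt0.
  have Fe : F (S e') by exists e'.
  have /Fc Fk : nbhs (lim F) (ball (lim F) (Num.sqrt e')%:C%C).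
    by apply: nbhsx_ballx; rewrite ltcR.
  have [f [/= fe]] := filter_ex (filterI Fe Fk).
  rewrite -ball_normE /= distrC norm_lt_sqn // sqr_sqrtr ?ltW // => fk.
  by exists f; rewrite (ltW fk).
have fmin g : energy phi f - e' <= energy phi g.
  by rewrite lerBlDr (le_trans (ltW fe)) // lerD2r.
have H1 := energy_near_min phil fmin h.
have H2 := le_trans (cauchy_schwarz h (f - lim F)) (ler_wpM2l (sqn_ge0 h) fk).
have H3 := sqmodD_le (phi h - dot h f) (dot h (f - lim F)).
rewrite (linearBr dot h) addrA subrK in H3.
have -> : e = 4 * e' * (sqn h + 1)
  by rewrite /e'; field; rewrite gt_eqF ?ltr_wpDl ?sqn_ge0.
rewrite (linearBr dot h) in H2; lra.
Qed.

End Hilbert.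

(** * Adjoints and inverses of bounded operators *)

Section Operators.
Context {R : realType} {Omega : Type} {H : rkhs R Omega}.
Local Notation dot := (rkhs_dot H).
Local Notation normE := (@rkhs_norm R Omega H).
Local Notation sqn := (sqn dot).
Implicit Types (A B : H -> H) (f g : H).

Lemma dot_ext f g : (forall h : H, dot h f = dot h g) -> f = g.
Proof.
move=> fg; apply/eqP; rewrite -subr_eq0 -(dnorm_eq0 dot).
by rewrite (linearBr dot) subr_eq0; apply/eqP/fg.
Qed.

Lemma bounded_comp A B :
  bounded_operator A -> bounded_operator B -> bounded_operator (A \o B).
Proof.
move=> [Al [M AM]] [Bl [N BN]]; split=> [a f g|]; first by rewrite /= Bl Al.
exists (`|M| * N) => f /=; rewrite -mulrA.
apply: le_trans (ler_wpM2l (normr_ge0 _) (BN f)).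
apply: le_trans (AM (B f)) _; rewrite -[X in _ <= _ * X]normr_id -normrM.
by rewrite ger0_norm // (le_trans (normr_ge0 _) (AM _)).
Qed.

Lemma normr_dot_le f g : `|dot f g| <= `|f| * `|g|.
Proof.
rewrite -ler_sqr ?nnegrE ?mulr_ge0 // exprMn !normE !(dotNn dot) -rmorphM /=.
by rewrite -add_Re2_Im2 lecR cauchy_schwarz.
Qed.

(** The vector [adjoint A g] represents the form [f |-> <A f, g>]. It inherits
    the bound [M] of [A], since [|B g|^2 = <A (B g), g> <= M |B g| |g|]. *)
Lemma adjointP A : bounded_operator A -> bounded_operator (adjoint A) /\
  forall f g, dot (A f) g = dot f (adjoint A g).
Proof.
move=> bA; have [Al [M AM]] := bA.
apply: (@xgetPex _ (fun=> 0) [set B : H -> H | bounded_operator B /\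
    forall f g : H, dot (A f) g = dot f (B g)]).
have rep g : exists k, forall f, dot (A f) g = dot f k.
  apply: (riesz normE (phi := fun f => dot (A f) g)).
    by move=> a u v; rewrite Al linearDl linearZl_LR.
  exists (M * `|g|) => f; rewrite mulrAC.
  by apply: le_trans (normr_dot_le (A f) g) _; apply: ler_wpM2r => //; apply: AM.
have [B BP] := choice rep; exists B; split=> //; split.
  move=> a u v; apply: dot_ext => h.
  by rewrite -BP linearDr !linearZr_LR /= linearDr linearZr_LR /= !BP.
exists M => g; have [->|Bg0] := eqVneq (B g) 0.
  by rewrite normr0 (le_trans _ (le_trans (normr_ge0 _) (AM g))).
rewrite -(ler_pM2l (x := `|B g|)) ?normr_gt0 // -expr2 normE -BP.
rewrite -[dot _ _]ger0_norm; last by rewrite BP dnorm_ge0.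
apply: le_trans (normr_dot_le _ _) _.
by rewrite mulrCA mulrA ler_wpM2r.
Qed.

Lemma adjointE A f g : bounded_operator A -> dot (A f) g = dot f (adjoint A g).
Proof. by move=> /adjointP[]. Qed.

Lemma adjointE_sym A f g :
  bounded_operator A -> dot (adjoint A f) g = dot f (A g).
Proof. by move=> bA; rewrite dotJ -adjointE // -dotJ. Qed.

Lemma adjoint_self A : bounded_operator A ->
  (forall f g, dot (A f) g = dot f (A g)) -> adjoint A = A.
Proof.
move=> bA sA; apply/funext => g; apply: dot_ext => h.
by rewrite -adjointE // sA.
Qed.

Lemma op_inv_eq A B : is_inverse A B -> op_inv A = B.
Proof.
move=> [bB ABK BAK]; have : is_inverse A (op_inv A).
  by apply: (@xgetPex _ (fun=> 0) (is_inverse A)); exists B.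
by move=> [_ invK _]; apply/funext => f; rewrite -{1}(BAK f) invK.
Qed.

Lemma inverse_adjoint_comp A B : bounded_operator A -> is_inverse A B ->
  is_inverse (adjoint A \o A) (B \o adjoint B).
Proof.
move=> bA [bB AB BAK].
have [[bA' _] [bB' _]] := (adjointP bA, adjointP bB).
have A'B' : cancel (adjoint A) (adjoint B).
  by move=> f; apply: dot_ext => h; rewrite -adjointE // -adjointE // BAK.
have B'A' : cancel (adjoint B) (adjoint A).
  by move=> f; apply: dot_ext => h; rewrite -adjointE // -adjointE // AB.
split; first exact: bounded_comp.
  by move=> f /=; rewrite A'B' AB.
by move=> f /=; rewrite BAK B'A'.
Qed.

End Operators.

(** * Reproducing kernels *)

Section Kernels.
Context {R : realType} {Omega : Type} {H : rkhs R Omega}.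
Hypothesis ker_neq0 : forall l : Omega, rkernel H l != 0.
Local Notation dot := (rkhs_dot H).

(** The default value of the choice that defines [rkernel] is 0, so a kernel
    that is not 0 was chosen among the representing vectors. *)
Lemma rkernelP l (f : H) : rkhs_val H f l = dot f (rkernel H l).
Proof.
move: f; have := ker_neq0 l; rewrite /rkernel.
by case: xgetP => [k _ kP _|_ /eqP] //; exact: kP.
Qed.

Lemma sqn_nrkernel l : sqn dot (nrkernel H l) = 1.
Proof.
apply: complexI; rewrite -dotNn -rkhs_norm /nrkernel normrZ normfV normr_id.
by rewrite mulVf ?expr1n // normr_eq0.
Qed.

Lemma nrkernel_ext (f g : H) :
  (forall l, dot f (nrkernel H l) = dot g (nrkernel H l)) -> f = g.
Proof.
move=> fg; apply: (@rkhs_val_inj R Omega H); apply/funext => l; rewrite !rkernelP.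
have := fg l; rewrite /nrkernel !linearZr_LR /=; apply: mulfI.
by rewrite conjC_eq0 invr_eq0 normr_eq0.
Qed.

(** Moving [T] to the kernel gives [<T f, k_l> = <f, T k_l> = <f, k_l>], so that
    [T f] and [f] take the same values. *)
Lemma self_adjoint_id (T : H -> H) :
    (forall f g, dot (T f) g = dot f (T g)) ->
  (forall l, T (nrkernel H l) = nrkernel H l) -> T = id.
Proof.
move=> sT Tk; apply/funext => f; apply: nrkernel_ext => l.
by rewrite sT Tk.
Qed.

End Kernels.

(** * The Berezin norm of a self-adjoint operator *)

Lemma mean_diag (R : realType) (s : R -> R -> R) a :
  is_mean s -> 0 <= a -> s a a = a.
Proof.
by move=> ms a0; apply: le_anti; rewrite andbC; exact: mean_between.
Qed.

Lemma ber_norm_le1 (R : realType) (Omega : Type) (H : rkhs R Omega)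
    (s : R -> R -> R) (p : R) (T : H -> H) :
    is_mean s -> 1 <= p -> adjoint T = T ->
  (ber_norm s p T <= 1)%E <->
  forall l m, absc (rkhs_dot H (T (nrkernel H l)) (nrkernel H m)) <= 1.
Proof.
move=> ms p1 aT; have p0 : p != 0 by rewrite gt_eqF // (lt_le_trans ltr01).
have E x : 0 <= x -> (s (x `^ p) (x `^ p)) `^ p^-1 = x.
  by move=> x0; rewrite mean_diag ?powR_ge0 // -powRrM mulfV // powRr1.
split=> [h l m|h].
  rewrite -lee_fin; apply: le_trans h; apply: ereal_sup_ubound.
  by exists l, m; rewrite aT E // absc_ge0.
apply: ge_ereal_sup => _ [l [m ->]].
by rewrite aT E ?absc_ge0 // lee_fin.
Qed.

(** * Characterization of unitary operators *)

Theorem theorem3p15 (R : realType) (Omega : Type) (hOmega : inhabited Omega)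
  (H : rkhs R Omega) (hker : forall l : Omega, rkernel H l != 0)
  (sigma : R -> R -> R) (hsigma : symmetric_mean sigma)
  (sigma_ : R -> R -> R -> R) (hpath : interpolation_path sigma sigma_)
  (t : R) (ht : 0 <= t <= 1) (p : R) (hp : 1 <= p)
  (A : H -> H) (hA : bounded_operator A) (hinv : invertible_operator A) :
  unitary_operator A <->
  (ber_norm (sigma_ t) p (adjoint A \o A) <= 1)%E /\
  (ber_norm (sigma_ t) p (op_inv (adjoint A \o A)) <= 1)%E.
Proof.
have ms := path_mean hpath ht.
have [B AB] := hinv; have [bB ABK BAK] := AB.
have [[bA' _] [bB' _]] := (adjointP hA, adjointP bB).
have TS := inverse_adjoint_comp hA AB.
have sT f g :
    rkhs_dot H ((adjoint A \o A) f) g = rkhs_dot H f ((adjoint A \o A) g).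
  by rewrite /= adjointE_sym // adjointE.
have sS f g :
    rkhs_dot H ((B \o adjoint B) f) g = rkhs_dot H f ((B \o adjoint B) g).
  by rewrite /= adjointE // adjointE_sym.
rewrite (op_inv_eq TS).
have T_ber := ber_norm_le1 ms hp (adjoint_self (bounded_comp bA' hA) sT).
have S_ber := ber_norm_le1 ms hp (adjoint_self (bounded_comp bB bB') sS).
split=> [[TE _]|[/T_ber Tle /S_ber Sle]].
  have SE : B \o adjoint B = id.
    by apply/funext => f; have [_ _ /(_ f)] := TS; rewrite TE.
  have le1 l m : absc (rkhs_dot H (nrkernel H l) (nrkernel H m)) <= 1.
    rewrite -(ler_sqr (absc_ge0 _)) ?nnegrE // expr1n absc_sqr.
    by rewrite (le_trans (cauchy_schwarz _ _ _)) // !sqn_nrkernel // mulr1.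
  by split; [apply/T_ber; rewrite TE | apply/S_ber; rewrite SE].
have TE : adjoint A \o A = id.
  apply: (self_adjoint_id hker sT) => l.
  set k := nrkernel H l.
  have Ak1 : sqn (rkhs_dot H) (A k) <= 1.
    by rewrite /sqn adjointE // (le_trans (Re_le_absc _)) // -sT Tle.
  have Bk1 : sqn (rkhs_dot H) (adjoint B k) <= 1.
    by rewrite /sqn -adjointE // (le_trans (Re_le_absc _)) // Sle.
  have ABk : rkhs_dot H (adjoint B k) (A k) = 1.
    by rewrite adjointE_sym // ABK dotNn sqn_nrkernel.
  (* The squared norm of the difference is at most 1 - 2 + 1. *)
  have eqk : A k = adjoint B k.
    apply/eqP; rewrite -subr_eq0; apply/eqP/(@sqn_eq0 R H (rkhs_dot H)).
    apply/eqP; rewrite eq_le sqn_ge0 andbT.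
    rewrite -scaleN1r sqn_addZ ABk /sqmod /=; lra.
  rewrite /= eqk; apply: dot_ext => h.
  by rewrite -!adjointE // ABK.
have EB : adjoint A = B.
  by apply/funext => f; rewrite -{1}(BAK f) -[RHS]/(id (B f)) -TE.
by split=> //; rewrite EB; apply/funext => f /=; rewrite BAK.
Qed.
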